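(* Let $R$ be a unital associative algebra over a field of characteristic zero that satisfies a polynomial identity, let $\delta$ be a derivation of $R$, and let $N$ be the nil radical of $R$. Then $\delta(N)\subseteq N$ and $J(R[x;\delta])=N[x;\delta]$. In particular, $J(R[x;\delta])=(J(R[x;\delta])\cap R)[x;\delta]$.
   Context: A derivation of $R$ is an additive map $\delta:R\to R$ with $\delta(ab)=\delta(a)b+a\delta(b)$ for all $a,b\in R$. The differential polynomial ring $R[x;\delta]$ is, as a set (and additive group), the set of all polynomials $a_nx^n+\cdots+a_1x+a_0$ with $n\ge 0$ and $a_0,\ldots,a_n\in R$; multiplication is determined by $xa=ax+\delta(a)$ for $a\in R$, extended by associativity and linearity. $R$ is identified with the subring of constant polynomials. For an ideal $I$ of $R$ with $\delta(I)\subseteq I$, $I[x;\delta]$ denotes the set of polynomials in $R[x;\delta]$ all of whose coefficients $a_i$ (written on the left of the powers of $x$) lie in $I$. $J(S)$ denotes the Jacobson radical of a ring $S$. An algebra $R$ over a field $k$ satisfies a polynomial identity if there is a nonzero polynomial $f(X_1,\ldots,X_m)$ in noncommuting variables with coefficients in $k$ such that $f(r_1,\ldots,r_m)=0$ for all $r_1,\ldots,r_m\in R$. The nil radical of a ring $R$ satisfying a polynomial identity is the sum of all nil right ideals of $R$ (a right ideal is nil if each of its elements is nilpotent); it is known to be a two-sided nil ideal. *)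

(* Defs.v *)
From HB Require Import structures.
From mathcomp Require Import all_boot all_algebra.
From mathcomp Require Import boolp classical_sets.
From mathcomp Require monalg.

Set Implicit Arguments.
Unset Strict Implicit.
Unset Printing Implicit Defensive.

Import GRing.Theory.
Local Open Scope ring_scope.
Local Open Scope classical_set_scope.

(* Additive only: a derivation of a k-algebra need not be k-linear. *)
HB.mixin Record isDerivation (R : nzRingType) (d : R -> R) := {
  derivationM : forall a b, d (a * b) = d a * b + a * d b
}.

#[short(type="derivation")]
HB.structure Definition Derivation (R : nzRingType) :=
  {d of isDerivation R d & @Algebra.Additive R R d}.

(* [d] is a phantom argument selecting the ring structure R[x; d]. *)
Definition diffpoly (R : nzRingType) (d : derivation R) : Type := {poly R}.

Section DiffPolyRing.
Variables (R : nzRingType) (d : derivation R).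
Local Notation diffpoly := (diffpoly d).

HB.instance Definition _ := GRing.Zmodule.on diffpoly.

(* Left multiplication by x, dictated by x * b = b * x + d b. *)
Definition dpX_act (q : {poly R}) : {poly R} := q * 'X + map_poly d q.

Definition dpmul (p q : diffpoly) : diffpoly :=
  \sum_(i < size (p : {poly R})) (p : {poly R})`_i *: iter i dpX_act q.

Definition dpC (a : R) : diffpoly := a%:P.
Definition dpX : diffpoly := 'X.

Lemma dpX_act_additive : {morph dpX_act : p q / p - q}.
Proof. by move=> p q; rewrite /dpX_act raddfB mulrBl opprD addrACA. Qed.

Lemma iter_dpX_act_additive i : {morph iter i dpX_act : p q / p - q}.
Proof. by move=> p q; elim: i => //= i ->; rewrite dpX_act_additive. Qed.

HB.instance Definition _ i := GRing.isZmodMorphism.Build {poly R} {poly R}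
  (iter i dpX_act) (iter_dpX_act_additive i).
HB.instance Definition _ := GRing.isZmodMorphism.Build {poly R} {poly R}
  dpX_act dpX_act_additive.

Lemma dpX_actZ a (q : {poly R}) :
  dpX_act (a *: q) = a *: dpX_act q + d a *: q.
Proof.
apply/polyP=> i; rewrite /dpX_act !(coefD, coefZ, coefMX) !coef_map /= coefZ.
rewrite derivationM mulrDr; case: eqP => _; rewrite ?mulr0 ?add0r.
  by rewrite addrC.
by rewrite -addrA; congr (_ + _); rewrite addrC.
Qed.

Lemma dpmul_wide n (p q : {poly R}) : (size p <= n)%N ->
  dpmul p q = \sum_(i < n) p`_i *: iter i dpX_act q.
Proof.
move=> le_p_n; rewrite /dpmul (big_ord_widen _ (fun i => p`_i *: iter i dpX_act q) le_p_n).
rewrite big_mkcond; apply: eq_bigr => i _.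
by case: ltnP => // le_p_i; rewrite nth_default // scale0r.
Qed.

Lemma dpmulDl : left_distributive dpmul +%R.
Proof.
move=> p1 p2 q; pose n := maxn (size (p1 : {poly R})) (size (p2 : {poly R})).
rewrite (@dpmul_wide n) ?(leq_trans (size_polyD _ _)) //.
rewrite (@dpmul_wide n p1) ?leq_maxl // (@dpmul_wide n p2) ?leq_maxr //.
by rewrite -big_split; apply: eq_bigr => i _; rewrite coefD scalerDl.
Qed.

Lemma dpmulDr : right_distributive dpmul +%R.
Proof.
move=> p q1 q2; rewrite /dpmul -big_split; apply: eq_bigr => i _ /=.
by rewrite (raddfD (iter i dpX_act)) scalerDr.
Qed.

Lemma dpmul_Zl a (p q : {poly R}) : dpmul (a *: p) q = a *: (dpmul p q : {poly R}).
Proof.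
rewrite (@dpmul_wide (size p)) ?size_scale_leq // /dpmul scaler_sumr.
by apply: eq_bigr => i _; rewrite coefZ scalerA.
Qed.

Lemma dpmul_X_act (p q : {poly R}) :
  dpmul (dpX_act p) q = dpX_act (dpmul p q : {poly R}).
Proof.
pose n := (size p).+1.
have -> : dpmul (dpX_act p) q = dpmul (p * 'X) q + dpmul (map_poly d p) q.
  exact: dpmulDl.
have le_pX : (size (p * 'X)%R <= n)%N.
  by rewrite (leq_trans (size_polyMleq _ _)) // size_polyX addn2.
rewrite (dpmul_wide _ le_pX).
rewrite (@dpmul_wide (size p) (map_poly d p)); last exact: size_poly.
rewrite big_ord_recl coefMX /= scale0r add0r -big_split /= /dpmul.
rewrite (raddf_sum dpX_act); apply: eq_bigr => i _.
by rewrite coefMX coef_map /= dpX_actZ.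
Qed.

Lemma dpmulA : associative dpmul.
Proof.
move=> p q r; rewrite [LHS]/dpmul [dpmul p q]/dpmul.
have suml n (F : 'I_n -> diffpoly) : dpmul (\sum_i F i) r = \sum_i dpmul (F i) r.
  elim/big_rec2: _ => [|i y1 y2 _ <-]; last exact: dpmulDl.
  by rewrite (@dpmul_wide 0) ?size_poly0 // big_ord0.
rewrite suml; apply: eq_bigr => i _; rewrite dpmul_Zl; congr (_ *: _).
by elim: (i : nat) => //= j ->; rewrite dpmul_X_act.
Qed.

Lemma dpmulCl a (q : {poly R}) : dpmul (dpC a) q = a *: q.
Proof. by rewrite (@dpmul_wide 1) ?size_polyC_leq1 // big_ord1 coefC. Qed.

Lemma dpmul1l : left_id (dpC 1) dpmul.
Proof. by move=> q; rewrite dpmulCl scale1r. Qed.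

Lemma iter_dpX_act1 i : iter i dpX_act 1 = 'X^i.
Proof.
elim: i => //= i ->; rewrite /dpX_act -exprSr -[RHS]addr0; congr (_ + _).
apply/polyP=> j; rewrite coef_map /= coef0 coefXn.
case: eqP => _; rewrite ?raddf0 //.
have := derivationM 1 1 : d (1 * 1) = _; rewrite !mulr1 !mul1r => /eqP.
by rewrite -subr_eq0 opprD addrA subrr sub0r oppr_eq0 => /eqP.
Qed.

Lemma dpmul1r : right_id (dpC 1) dpmul.
Proof.
move=> p; rewrite -[RHS](coefK (p : {poly R})) poly_def /dpmul.
by apply: eq_bigr => i _; rewrite [dpC 1]/(1 : {poly R}) iter_dpX_act1.
Qed.

Lemma dpC1_neq0 : dpC 1 != 0.
Proof. exact: oner_neq0. Qed.

HB.instance Definition _ := GRing.Zmodule_isNzRing.Build diffpoly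
  dpmulA dpmul1l dpmul1r dpmulDl dpmulDr dpC1_neq0.

Lemma dpC_additive : {morph dpC : a b / a - b}.
Proof. by move=> a b; rewrite /dpC polyCB. Qed.

Lemma dpC_monoid_morphism : monoid_morphism dpC.
Proof.
split=> [//|a b]; rewrite -[RHS]/(dpmul (dpC a) (dpC b)) dpmulCl.
by rewrite /dpC -mul_polyC -polyCM.
Qed.

HB.instance Definition _ := GRing.isZmodMorphism.Build R diffpoly
  dpC dpC_additive.
HB.instance Definition _ := GRing.isMonoidMorphism.Build R diffpoly
  dpC dpC_monoid_morphism.

Lemma dpX_mulC a : dpX * dpC a = dpC a * dpX + dpC (d a).
Proof.
rewrite -[dpX * _]/(dpmul dpX (dpC a)) -[dpC a * dpX]/(dpmul (dpC a) dpX) dpmulCl.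
rewrite (@dpmul_wide 2) ?size_polyX // !big_ord_recl big_ord0 !coefX /=.
rewrite scale0r add0r addr0 scale1r /dpX_act map_polyC /=.
by rewrite -mul_polyC.
Qed.

Lemma dpE (p : diffpoly) :
  p = \sum_(i < size (p : {poly R})) dpC (p : {poly R})`_i * dpX ^+ i.
Proof.
have dpXn i : dpX ^+ i = 'X^i :> {poly R}.
  elim: i => // i IHi; rewrite exprS -[LHS]/(dpmul dpX (dpX ^+ i)).
  rewrite (@dpmul_wide 2) ?size_polyX // !big_ord_recl big_ord0 !coefX /=.
  rewrite scale0r add0r addr0 scale1r IHi -iter_dpX_act1 -[RHS]iter_dpX_act1.
  by rewrite iterS.
rewrite -[LHS](coefK (p : {poly R})) poly_def; apply: eq_bigr => i _.
by rewrite -[RHS]/(dpmul (dpC _) _) dpmulCl dpXn.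
Qed.

Definition dp_over (I : set R) : set diffpoly :=
  [set p : diffpoly | forall i, I (p : {poly R})`_i].

End DiffPolyRing.

Arguments dp_over [R] d I.

Section Radicals.
Variable R : nzRingType.
Implicit Types I M : set R.

Definition right_ideal I : Prop :=
  [/\ I 0, forall a b, I a -> I b -> I (a + b) & forall a r, I a -> I (a * r)].

Definition maximal_right_ideal M : Prop :=
  [/\ right_ideal M, M <> setT &
    forall I, right_ideal I -> M `<=` I -> I <> setT -> I = M].

Definition jacobson : set R := \bigcap_(M in maximal_right_ideal) M.

Definition nil I : Prop := forall a, I a -> exists n, a ^+ n = 0.

(* The sum of a possibly infinite family of right ideals consists of the finite
   sums of elements of its members. *)
Definition nil_radical : set R :=
  [set a | exists2 s : seq R, a = \sum_(b <- s) b &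
    forall b, b \in s -> exists I, [/\ right_ideal I, nil I & I b]].

End Radicals.

Arguments jacobson R : clear implicits.
Arguments nil_radical R : clear implicits.

Section PolynomialIdentity.
Import monalg.
Variables (k : fieldType) (R : algType k).

(* [fmonom I] is the free monoid on I, so [malg (fmonom 'I_m) k] is the free
   algebra k<X_1, ..., X_m>. *)
Definition nc_eval m (r : 'I_m -> R) (f : malg (fmonom 'I_m) k) : R :=
  mmap (in_alg R) (fun w : fmonom 'I_m => \prod_(i <- w) r i) f.

Definition satisfies_PI : Prop :=
  exists m (f : malg (fmonom 'I_m) k),
    f != 0 /\ forall r : 'I_m -> R, nc_eval r f = 0.

End PolynomialIdentity.

(* Main.v *)
Require Import Defs.
From HB Require Import structures.
From mathcomp Require Import all_boot all_algebra.
From mathcomp Require Import boolp classical_sets.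
From mathcomp Require Import zify.
From mathcomp Require monalg.

Set Implicit Arguments.
Unset Strict Implicit.
Unset Printing Implicit Defensive.

Import GRing.Theory.
Local Open Scope ring_scope.
Local Open Scope classical_set_scope.

(** An ideal is a set here, and computations take place modulo an ideal rather
    than in a quotient ring.

    The polynomial identity enters through a single consequence, [triangular]:
    for some d and modulo any ideal, if u_i u_j = 0 whenever j <= i < d, then
    u_0 ... u_(d-1) = 0.  With d the least degree of a monomial of the identity,
    substituting suitable sums of the u_i for the variables kills every
    monomial but one ([PI_triangular]).  Taking u_i = x_i r_i y_(i+1) with
    y_i x_j = 0 for j < i gives [triangular_interleave].  Modulo a prime ideal
    it bounds the length of chains of annihilators.  It follows that, modulo a
    prime, a nil right ideal is zero ([nil_mod_prime]) and a nonzero ideal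
    contains an element with zero right annihilator
    ([ideal_regular_mod_prime]).

    Zorn's lemma, applied to the ideals that contain, for no n, all words of
    length n in a finite set F, shows that the intersection of the primes is
    locally nilpotent ([words_prime]).  So the nil radical N is that
    intersection ([nil_radicalE]).  In characteristic zero the Leibniz formula
    shows that the largest derivation-stable ideal inside a prime is again
    prime ([delta_core_prime]).  Hence N is an intersection of
    derivation-stable primes, and is itself stable.

    To see that J lies in N[x; delta], suppose that some f in J has a
    coefficient outside a stable prime P.  The coefficients that occur, modulo
    P, at the top degree n of f among the members of J of degree at most n form
    an ideal not inside P, so some h in J has a leading coefficient that is
    regular modulo P.  But 1 - x h is right invertible and has a regular
    leading coefficient in degree n + 1 > 0, which is absurd
    ([jacobson_over_prime]).

    Conversely N[x; delta] is a right ideal, and it is nil.  Indeed, if F is a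
    finite subset of N, [triangular_interleave] shows that the products of d
    elements of F generate a nilpotent ideal; so every finite subset of N^d
    generates a nilpotent ideal ([prime_radical_pow_strongly_nilpotent]).  If f
    is in N[x; delta], then g = f^d has coefficients in N^d.  Expanding g^n
    gives words in iterated derivatives of the coefficients of g, and the
    total number of derivations applied in a word is at most n times the size
    of g.  So at least half of its letters belong to a fixed finite subset of
    N^d, and the word vanishes for large n ([strongly_nilpotent_coef_nil]). *)

(** * Two-sided ideals *)

Record ideal (R : nzRingType) (I : set R) : Prop := Ideal {
  ideal_0 : I 0;
  ideal_D : forall a b, I a -> I b -> I (a + b);
  ideal_Ml : forall r a, I a -> I (r * a);
  ideal_Mr : forall a r, I a -> I (a * r) }.

Section Ideals.
Variable R : nzRingType.
Implicit Types (I : set R) (a b r : R).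

Lemma ideal_N I a : ideal I -> I a -> I (- a).
Proof. by move=> idI Ia; rewrite -mulN1r; apply: ideal_Ml. Qed.

Lemma ideal_B I a b : ideal I -> I a -> I b -> I (a - b).
Proof. by move=> idI Ia Ib; apply: ideal_D => //; apply: ideal_N. Qed.

Lemma ideal_congr I a b : ideal I -> I (a - b) -> I b -> I a.
Proof. by move=> idI Iab Ib; rewrite -[a](subrK b); apply: ideal_D. Qed.

Lemma ideal_sum (T : Type) (s : seq T) (Q : pred T) (F : T -> R) I :
  ideal I -> (forall t, Q t -> I (F t)) -> I (\sum_(t <- s | Q t) F t).
Proof.
by move=> idI IF; elim/big_ind: _ => //; [exact: ideal_0 | exact: ideal_D].
Qed.

Lemma ideal_right I : ideal I -> right_ideal I.
Proof. by case. Qed.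

End Ideals.

(** * A polynomial identity forces triangular products to vanish *)
(** The condition on the pairs includes i = j, so modulo Q the only words in the
    u_i that survive are those with strictly increasing indices. *)
Definition triangular (R : nzRingType) d : Prop :=
  forall (Q : set R) (u : nat -> R), ideal Q ->
    (forall i j, (j <= i < d)%N -> Q (u i * u j)) -> Q (\prod_(i < d) u i).

Section PolynomialIdentity.
Import monalg.
Variables (k : fieldType) (R : algType k).

Section Word.
Variables (T : eqType) (w0 : seq T) (Q : set R) (u : nat -> R).
Local Notation d := (size w0).
Hypotheses (idQ : ideal Q)
  (uQ : forall i j, (j <= i < d)%N -> Q (u i * u j)).
Let X v : R := \sum_(i < d | ohead (drop i w0) == Some v) u i.

(** Evaluate a word at X_v = sum of the u_i over the positions i at which w0 has
    the letter v.  Only increasing products of the u_i survive, and a word that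
    is at least as long as w0 leaves room for u_0 u_1 ... u_(d-1) only, which it
    produces exactly when it is w0.  For the induction the evaluation starts at
    position p, behind a factor a that annihilates the earlier u_j. *)
Lemma word_subst w p a : (p <= d)%N -> (d <= size w + p)%N ->
  (forall j, (j < p)%N -> Q (a * u j)) ->
  Q (a * (\prod_(v <- w) X v)
     - (w == drop p w0)%:R * (a * \prod_(p <= i < d) u i)).
Proof.
elim: w p a => [|v w IHw] p a le_pd le_dp Qa.
  have -> : p = d by apply/eqP; rewrite eqn_leq le_pd.
  rewrite drop_size eqxx big_nil big_geq // mul1r subrr; exact: ideal_0.
rewrite big_cons mulrA /X mulr_sumr mulr_suml.
have step (j : 'I_d) : (p <= j)%N -> Q (a * u j * (\prod_(v <- w) X v)
     - (w == drop j.+1 w0)%:R * (a * u j * \prod_(j.+1 <= i < d) u i)).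
  move=> le_pj; apply: IHw => //.
    by rewrite addnS (leq_trans le_dp) //= addSn ltnS leq_add2l.
  move=> i lt_ij; rewrite -mulrA; apply: ideal_Ml => //; apply: uQ.
  by rewrite -ltnS lt_ij /=.
case: (ltnP p d) => [lt_pd|le_dp']; last first.
  rewrite drop_oversize // mul0r subr0; apply: ideal_sum => // j _.
  apply: ideal_Mr => //; apply: Qa; exact: leq_trans (ltn_ord j) le_dp'.
have other (j : 'I_d) : (j : nat) != p -> Q (a * u j * (\prod_(v <- w) X v)).
  case: (ltngtP j p) => // [lt_jp|lt_pj] _.
    by apply: ideal_Mr => //; apply: Qa.
  apply: ideal_congr (step j (ltnW lt_pj)) _ => //.
  (* Past p there are too few positions left for the letters of w. *)
  case: eqP => [Ew|_]; last by rewrite mul0r; apply: ideal_0.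
  by move: le_dp (ltn_ord j); rewrite Ew /= size_drop; lia.
pose j0 := Ordinal lt_pd.
case def_wp: (drop p w0) => [|v1 w1].
  by move/(congr1 size): def_wp; rewrite size_drop /=; lia.
have def_w1: drop p.+1 w0 = w1 by rewrite -add1n -drop_drop def_wp /= drop0.
rewrite eqseq_cons; case: (altP (v =P v1)) => [Ev|neq_v] /=; last first.
  rewrite mul0r subr0; apply: ideal_sum => // j /eqP Ej; apply: other.
  by apply: contra neq_v => /eqP Ejp; move: Ej; rewrite Ejp def_wp => -[->].
rewrite (bigD1 j0) /=; last by rewrite def_wp Ev.
rewrite addrAC; apply: ideal_D => //; last first.
  by apply: ideal_sum => // j /andP[_ ne_j]; apply: other; apply: contra ne_j.
by rewrite big_ltn // [a * (_ * _)]mulrA -def_w1; apply: (step j0).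
Qed.

End Word.

(** In the substitution of [word_subst] for a monomial w0 of least degree, all
    other monomials of the identity vanish modulo Q. *)
Lemma PI_triangular : satisfies_PI R -> exists d, triangular R d.
Proof.
move=> [m [f [f_neq0 fR0]]].
pose hasw n :=
  `[< exists2 w : fmonom 'I_m, mcoeff w f != 0 & size w = n >].
have ex_n : exists n, hasw n.
  have [w fw] : exists w, mcoeff w f != 0.
    apply: contrapT => noW; case/eqP: f_neq0; apply/malgP => w.
    rewrite mcoeff0; apply/eqP; apply: contrapT => fw.
    by apply: noW; exists w; apply/negP.
  by exists (size w); apply/asboolP; exists w.
case: (ex_minnP ex_n) => d /asboolP[w0 w0f <-] min_d.
exists (size w0) => Q u idQ uQ.
pose X v : R := \sum_(i < size w0 | ohead (drop i w0) == Some v) u i.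
have Xw (w : fmonom 'I_m) : mcoeff w f != 0 ->
    Q (\prod_(v <- w) X v - (w == w0)%:R * \prod_(i < size w0) u i).
  move=> fw; have := @word_subst _ w0 Q u idQ uQ w 0 1; rewrite !mul1r drop0 addn0.
  by rewrite big_mkord; apply=> //; apply: min_d; apply/asboolP; exists w.
have := fR0 X; rewrite /nc_eval mmapE (bigD1_seq w0) /=; last first.
- exact: finmap.fset_uniq.
- by rewrite mcoeff_neq0 in w0f.
move/eqP; rewrite addr_eq0 => /eqP f_w0.
have Qw0 : Q ((mcoeff w0 f)%:A * \prod_(v <- w0) X v).
  rewrite f_w0; apply: ideal_N => //; rewrite big_seq_cond; apply: ideal_sum => //.
  move=> w /andP[w_f /negPf ne_w]; apply: ideal_Ml => //.
  by have := Xw w; rewrite ne_w mul0r subr0; apply; rewrite mcoeff_neq0.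
rewrite -[X in Q X]scale1r -(mulVf w0f) -scalerA -mulr_algl; apply: ideal_Ml => //.
rewrite -mulr_algl -[X in _ * X](subKr (\prod_(v <- w0) X v)) mulrBr.
apply: ideal_B => //; apply: ideal_Ml => //.
by have := Xw w0 w0f; rewrite eqxx mul1r.
Qed.

End PolynomialIdentity.

(** * Chains of annihilators modulo a prime ideal *)
Record prime_ideal (R : nzRingType) (P : set R) : Prop := PrimeIdeal {
  prime_ideal_ideal : ideal P;
  prime_ideal_proper : ~ P 1;
  prime_ideal_prime : forall a b, (forall r, P (a * r * b)) -> P a \/ P b }.

Section TriangularRings.
Variables (R : nzRingType) (d : nat) (triR : triangular R d).
Implicit Types Q P D : set R.

(** The factors x_i r_i y_(i+1) satisfy the hypothesis of [triangular], because
    their products contain some y_i x_j with j < i. *)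
Lemma triangular_interleave Q (x y r : nat -> R) : ideal Q ->
    (forall i j, (j < i <= d)%N -> Q (y i * x j)) ->
  Q (y 0 * x 0 * \prod_(i < d) (r i * (y i.+1 * x i.+1))).
Proof.
move=> idQ Qyx; pose u i := x i * r i * y i.+1.
have Qu : Q (\prod_(i < d) u i).
  apply: triR => // i j /andP[le_ji lt_id]; rewrite /u -!mulrA.
  do 2!apply: ideal_Ml => //; rewrite !mulrA; do 2!apply: ideal_Mr => //.
  by apply: Qyx; rewrite ltnS le_ji.
suff -> : y 0 * x 0 * \prod_(i < d) (r i * (y i.+1 * x i.+1))
          = y 0 * (\prod_(i < d) u i) * x d.
  by apply: ideal_Mr => //; apply: ideal_Ml.
elim: d => [|n IHn]; first by rewrite !big_ord0 !mulr1.
by rewrite !big_ord_recr /= mulrA IHn /u !mulrA.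
Qed.

Section ModuloPrime.
Variables (P : set R) (primeP : prime_ideal P).
Let idP : ideal P := prime_ideal_ideal primeP.

Lemma prime_interleave n (w : nat -> R) : (forall i, (i <= n)%N -> ~ P (w i)) ->
  exists r : nat -> R, ~ P (w 0 * \prod_(i < n) (r i * w i.+1)).
Proof.
elim: n => [|n IHn] Pw; first by exists w; rewrite big_ord0 mulr1; apply: Pw.
have [|r Pr] := IHn; first by move=> i le_in; apply: Pw; apply: leqW.
set a := w 0 * _ in Pr.
have [s Ps] : exists s, ~ P (a * s * w n.+1).
  apply: contrapT => noS; have [] := prime_ideal_prime primeP (a := a) (b := w n.+1).
  - by move=> s; apply: contrapT => Ps; apply: noS; exists s.
  - exact: Pr.
  - exact: Pw.
exists (fun i => if i == n then s else r i); rewrite big_ord_recr /= eqxx.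
rewrite mulrA [X in X * _](_ : _ = a) ?mulrA // /a; congr (_ * _).
by apply: eq_bigr => i _; rewrite ltn_eqF.
Qed.

(** The indices are reversed with respect to [triangular_interleave], so as to
    fit sequences that are constructed step by step. *)
Lemma prime_no_triangle (x y : nat -> R) : (forall i, (i <= d)%N -> ~ P (y i * x i)) ->
  (forall i j, (i < j <= d)%N -> P (y i * x j)) -> False.
Proof.
move=> Pxy Pyx; pose x' i := x (d - i)%N; pose y' i := y (d - i)%N.
have [i le_id|r] := @prime_interleave d (fun i => y' i * x' i).
  by apply: Pxy; apply: leq_subr.
by apply; apply: (@triangular_interleave P x' y') => // i j lt_ji; apply: Pyx; lia.
Qed.

(** The right annihilators of the powers of c stop growing at the exponent d:
    otherwise x_i = c^i s and y_i = c^(n - i) would contradict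
    [prime_no_triangle]. *)
Lemma annr_expr_stable c n s : (d <= n)%N -> P (c ^+ n.+1 * s) -> P (c ^+ n * s).
Proof.
move=> le_dn Pcs; apply: contrapT => Ncs.
apply: (@prime_no_triangle (fun i => c ^+ i * s) (fun i => c ^+ (n - i))).
  by move=> i le_id; rewrite mulrA -exprD subnK ?(leq_trans le_id).
move=> i j lt_ij; rewrite mulrA -exprD.
have -> : (n - i + j = (j - i.+1) + n.+1)%N by lia.
by rewrite exprD -mulrA; apply: ideal_Ml.
Qed.

(** Otherwise, by choice, there is a sequence x_0, x_0 z_0, x_0 z_0 z_1, ... whose
    left annihilators strictly increase, with witnesses y_i. *)
Lemma no_annl_chain (D : set R) : (exists2 x, D x & ~ P x) ->
  (forall x, D x -> ~ P x -> exists z y, [/\ D (x * z), ~ P (x * z),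
      P (y * (x * z)) & ~ P (y * x)]) -> False.
Proof.
move=> [x0 Dx0 Px0] step.
have [zy zyP] : {zy : R -> R * R & forall x, D x -> ~ P x -> [/\ D (x * (zy x).1),
    ~ P (x * (zy x).1), P ((zy x).2 * (x * (zy x).1)) & ~ P ((zy x).2 * x)]}.
  apply: (@choice R (R * R) (fun x zy => D x -> ~ P x -> [/\ D (x * zy.1), ~ P (x * zy.1),
    P (zy.2 * (x * zy.1)) & ~ P (zy.2 * x)])) => x.
  have [[Dx Px]|nx] := pselect (D x /\ ~ P x); last by exists (0, 0) => ? ?; case: nx.
  by have [z [y zyP]] := step x Dx Px; exists (z, y).
pose x n := iter n (fun x => x * (zy x).1) x0.
have [Dx Px] : (forall n, D (x n)) /\ (forall n, ~ P (x n)).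
  by apply/all_and2; elim=> //= n [Dx Px]; have [] := zyP _ Dx Px.
apply: (@prime_no_triangle x (fun n => (zy (x n)).2)) => [i _|i j /andP[lt_ij _]].
  by have [] := zyP _ (Dx i) (Px i).
rewrite -(subnK lt_ij); elim: (j - i.+1)%N => [|n IHn] /=.
  by have [] := zyP _ (Dx i) (Px i).
by rewrite mulrA; apply: ideal_Mr.
Qed.

(** Otherwise there is a sequence c_0, c_1, ... whose right annihilators strictly
    decrease, with witnesses e_i; take x_i = e_i and y_i = c_(i+1). *)
Lemma no_annr_chain (D : set R) : D !=set0 ->
  (forall c, D c -> exists c' e, [/\ D c', P (c * e), ~ P (c' * e) &
      forall b, P (c' * b) -> P (c * b)]) -> False.
Proof.
move=> [c0 Dc0] step.
have [ce ceP] : {ce : R -> R * R & forall c, D c -> [/\ D (ce c).1,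
    P (c * (ce c).2), ~ P ((ce c).1 * (ce c).2) & forall b, P ((ce c).1 * b) -> P (c * b)]}.
  apply: (@choice R (R * R) (fun c ce => D c -> [/\ D ce.1,
    P (c * ce.2), ~ P (ce.1 * ce.2) & forall b, P (ce.1 * b) -> P (c * b)])) => c.
  have [Dc|nc] := pselect (D c); last by exists (0, 0).
  by have [c' [e ceP]] := step c Dc; exists (c', e).
pose c n := iter n (fun c => (ce c).1) c0.
have Dc n : D (c n) by elim: n => //= n /ceP[].
apply: (@prime_no_triangle (fun n => (ce (c n)).2) (fun n => c n.+1)).
  by move=> i _; have [] := ceP _ (Dc i).
move=> i j /andP[lt_ij _].
have [_ + _ _] := ceP _ (Dc j); set e := (ce (c j)).2.
rewrite -(subnK lt_ij); elim: (j - i.+1)%N => //= n IHn Pe.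
by apply: IHn; have [_ _ _] := ceP _ (Dc (n + i.+1)%N); apply.
Qed.

(** Take x in D outside P with a maximal left annihilator modulo P.  If x r is
    nilpotent and z^t x is the last nonzero power for z = x r, then z^t x is a
    right multiple of x killed by z, so z x = 0 by maximality.  Thus x R x is
    zero modulo P. *)
Lemma nil_mod_prime (D : set R) : right_ideal D ->
  (forall a, D a -> exists n, P (a ^+ n)) -> D `<=` P.
Proof.
move=> [D0 DD DM] nilD a Da; apply: contrapT => Pa.
apply: (@no_annl_chain D); first by exists a.
move=> x Dx Px; apply: contrapT => noz.
have [|//|//] := prime_ideal_prime primeP (a := x) (b := x).
move=> r; apply: contrapT => Pxrx; pose z := x * r.
have [n Pzn] := nilD z (DM _ _ Dx).
have ex_n : exists n, `[< P (z ^+ n * x) >].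
  by exists n; apply/asboolP; apply: ideal_Mr.
case: (ex_minnP ex_n) => -[|t] /asboolP Pzt min_t; first by rewrite mul1r in Pzt.
have def_zt : z ^+ t * x = x * (r * x) ^+ t.
  by elim: t {Pzt min_t} => [|t IHt]; rewrite ?mul1r ?mulr1 // !exprS -mulrA IHt /z !mulrA.
apply: noz; exists ((r * x) ^+ t), z; rewrite -def_zt mulrA -exprS; split=> //.
  by rewrite def_zt; apply: DM.
move=> Pzt'; suff: (t < t)%N by rewrite ltnn.
by apply: min_t; apply/asboolP.
Qed.

(** Among the elements c of A such that c^2 and c have the same right annihilator,
    take one whose right annihilator is minimal.  If that is not zero, its
    intersection with A contains a non-nilpotent x, whose power e = x^(d+1) has
    the same right annihilator as its square; then c + e has a smaller right
    annihilator than c. *)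
Lemma ideal_regular_mod_prime (A : set R) : ideal A -> ~ A `<=` P ->
  exists2 c, A c & forall b, P (c * b) -> P b.
Proof.
move=> idA /existsNP[a0 /not_implyP[Aa0 Pa0]]; apply: contrapT => noc.
pose D c := A c /\ (forall b, P (c * c * b) -> P (c * b)).
apply: (@no_annr_chain D) => [|c [Ac regc]].
  by exists 0; split; [exact: ideal_0 | move=> b; rewrite mulr0].
have [b Pcb Pb] : exists2 b, P (c * b) & ~ P b.
  apply: contrapT => nob; apply: noc; exists c => // b Pcb.
  by apply: contrapT => Pb; apply: nob; exists b.
have [r Pbra] : exists r, ~ P (b * r * a0).
  apply: contrapT => noR; have [] := prime_ideal_prime primeP (a := b) (b := a0) => //.
  by move=> r; apply: contrapT => Pr; apply: noR; exists r.
pose B e := A e /\ P (c * e).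
have rB : right_ideal B.
  split=> [|x y [Ax Px] [Ay Py]|x s [Ax Px]]; split.
  - exact: ideal_0.
  - by rewrite mulr0; apply: ideal_0.
  - exact: ideal_D.
  - by rewrite mulrDr; apply: ideal_D.
  - exact: ideal_Mr.
  - by rewrite mulrA; apply: ideal_Mr.
have [x Bx Px] : exists2 x, B x & forall n, ~ P (x ^+ n).
  apply: contrapT => noX; apply: Pbra; apply: (nil_mod_prime rB).
    move=> x Bx; apply: contrapT => noN; apply: noX; exists x => // n Pn.
    by apply: noN; exists n.
  by split; [apply: ideal_Ml | rewrite -mulrA mulrA; apply: ideal_Mr].
pose e := x ^+ d.+1.
have [Ae Pce] : B e by rewrite /e exprS; case: rB => _ _; apply.
have rege b' : P (e * e * b') -> P (e * b').
  rewrite /e -exprD; elim: {1}d.+1 => [//|n IHn].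
  by rewrite addSn => /annr_expr_stable Pn; apply: IHn; apply: Pn; lia.
(* As c e = 0, multiplying by c on the left removes e from c + e. *)
have cC t : P (c * ((c + e) * t)) -> P (c * t).
  move=> PcCt; apply: regc; rewrite -mulrA.
  have -> : c * (c * t) = c * ((c + e) * t) - c * e * t.
    by rewrite mulrDl mulrDr -!mulrA addrK.
  by apply: ideal_B => //; apply: ideal_Mr.
have Pee t : P ((c + e) * (c + e) * t) -> P (c * t) /\ P (e * t).
  rewrite -mulrA => PCCt; have PcCt := cC _ (ideal_Ml idP c PCCt).
  have Pct := cC _ PcCt; split=> //; apply: rege.
  have -> : e * e * t = (c + e) * ((c + e) * t) - c * ((c + e) * t) - e * (c * t).
    rewrite [in RHS]mulrDl [c * _ + _]addrC addrK mulrDl mulrDr.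
    by rewrite [e * _ + _]addrC addrK mulrA.
  by apply: ideal_B => //; [apply: ideal_B | apply: ideal_Ml].
exists (c + e), e; split.
- split; first exact: ideal_D.
  by move=> b' /Pee[Pc Pe]; rewrite mulrDl; apply: ideal_D.
- exact: Pce.
- rewrite mulrDl => Pcee.
  have: P (e * e) by rewrite -[e * e](addKr (c * e)); apply: ideal_D => //; apply: ideal_N.
  by rewrite /e -exprD; apply: Px.
move=> b' Pceb'; apply: (proj1 (Pee b' _)).
by rewrite -mulrA; apply: ideal_Ml.
Qed.

End ModuloPrime.
End TriangularRings.

(** * The prime radical *)
Section PrimeRadical.
Variable R : nzRingType.
Implicit Types (F W : seq R) (I P A B X Y : set R).

(** The list form makes every set of words visibly finite, which the chain
    condition in [words_prime] depends on. *)
Fixpoint words F n : seq R :=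
  if n is m.+1 then [seq a * w | a <- F, w <- words F m] else [:: 1].

Lemma words_split F m n w : w \in words F (m + n) ->
  exists u v, [/\ u \in words F m, v \in words F n & w = u * v].
Proof.
elim: m w => [|m IHm] w /= Fw.
  by exists 1, w; rewrite mem_head mul1r.
case/allpairsP: Fw => -[a w'] /= [Fa /IHm[u [v [Fu Fv ->]]] ->].
by exists (a * u), v; rewrite mulrA; split=> //; apply/allpairsP; exists (a, u).
Qed.

Lemma words_cat F m n u v :
  u \in words F m -> v \in words F n -> u * v \in words F (m + n).
Proof.
elim: m u => [|m IHm] u /=; first by rewrite inE => /eqP-> ; rewrite mul1r.
case/allpairsP=> -[a w] /= [Fa Fw ->] Fv; apply/allpairsP; exists (a, w * v).
by rewrite mulrA; split=> //; apply: IHm.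
Qed.

Lemma words_sub F F' n : {subset F <= F'} -> {subset words F n <= words F' n}.
Proof.
move=> sFF'; elim: n => [|n IHn] w //=.
case/allpairsP=> -[a v] /= [Fa Fv ->]; apply/allpairsP.
by exists (a, v); split; [apply: sFF' | apply: IHn |].
Qed.

Definition colonl A X : set R := [set a | forall r x, X x -> A (a * r * x)].

Lemma colonl_ideal A X : ideal A -> ideal (colonl A X).
Proof.
move=> idA; split=> [r x _|a b Aa Ab r x Xx|s a Aa r x Xx|a s Aa r x Xx].
- by rewrite !mul0r; apply: ideal_0.
- by rewrite !mulrDl; apply: ideal_D; auto.
- by rewrite -2!mulrA (mulrA a); apply: ideal_Ml; auto.
- by rewrite -[a * s * r]mulrA; apply: Aa.
Qed.

Lemma colonr_ideal A X : ideal A ->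
  ideal [set y | forall x, X x -> forall r, A (x * r * y)].
Proof.
move=> idA; split=> [x Xx r|y z Ay Az x Xx r|s y Ay x Xx r|y s Ay x Xx r] /=.
- by rewrite mulr0; apply: ideal_0.
- by rewrite mulrDr; apply: ideal_D; auto.
- by rewrite mulrA -[x * r * s]mulrA; apply: Ay.
- by rewrite mulrA; apply: ideal_Mr; auto.
Qed.

(** An ideal A is maximal among those that contain no set [words F n].  If a R b
    lies in A but a and b do not, the colon ideals of A show that A contains
    all products of a word of some length m with a word of some length n, that
    is, all words of length m + n. *)
Lemma words_prime F : (forall n, exists2 w, w \in words F n & w != 0) ->
  exists2 P, prime_ideal P & exists2 a, a \in F & ~ P a.
Proof.
move=> Fn0; pose avoids I := forall n, exists2 w, w \in words F n & ~ I w.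
pose Z I := [/\ forall a b, I a -> I b -> I (a + b), forall r a, I a -> I (r * a),
  forall a r, I a -> I (a * r) & avoids I].
have [C sCZ totC|A [[AD AMl AMr avA] maxA]] := @Zorn_bigcup R Z.
  split=> [a b [X CX Xa] [Y CY Yb]|r a [X CX Xa]|a r [X CX Xa]|n].
  - have [sXY|sYX] := totC X Y CX CY.
      by exists Y => //; have [YD _ _ _] := sCZ _ CY; apply: YD => //; apply: sXY.
    by exists X => //; have [XD _ _ _] := sCZ _ CX; apply: XD => //; apply: sYX.
  - by exists X => //; have [_ XM _ _] := sCZ _ CX; apply: XM.
  - by exists X => //; have [_ _ XM _] := sCZ _ CX; apply: XM.
  (* A finite set covered by a chain is contained in one of its members. *)
  have subC W : {in W, forall w, (\bigcup_(X in C) X) w} ->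
      W = [::] \/ exists2 X, C X & {in W, forall w, X w}.
    elim: W => [|w W IHW] CW; [by left | right].
    have [X CX Xw] := CW w (mem_head _ _).
    have [v Wv|W0|[Y CY YW]] := IHW; first by apply: CW; rewrite inE Wv orbT.
      by exists X => // v; rewrite W0 inE => /eqP->.
    have [sXY|sYX] := totC X Y CX CY.
      by exists Y => // v; rewrite inE => /predU1P[->|/YW//]; apply: sXY.
    by exists X => // v; rewrite inE => /predU1P[->//|/YW]; apply: sYX.
  apply: contrapT => noW.
  have [v Wv|W0|[X CX XW]] := subC (words F n).
  - by apply: contrapT => Cv; apply: noW; exists v.
  - by have [w] := Fn0 n; rewrite W0.
  - by have [_ _ _ /(_ n)[w /XW]] := sCZ _ CX.
(* The union of the empty chain is empty, so the members of Z need not contain 0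
   by definition; the maximal one does, or else {0} would be larger. *)
have A0 : A 0.
  apply: contrapT => nA0; apply: (maxA [set 0]).
    split=> [a Aa|]; last by move/(_ 0 erefl).
    by case: nA0; rewrite -(mul0r a); apply: AMl.
  split=> [a b -> ->|r a ->|a r ->|n] /=; rewrite ?addr0 ?mulr0 ?mul0r //.
  by have [w Fw w0] := Fn0 n; exists w => // /eqP; apply/negP.
have idA : ideal A by split.
have bigger B : ideal B -> A `<=` B -> ~ B `<=` A ->
    exists n, {in words F n, forall w, B w}.
  move=> idB sAB nsBA; apply: contrapT => noN; apply: (maxA B); first by split.
  split; try by case: idB.
  move=> n; apply: contrapT => nw; apply: noN; exists n => w Fw.
  by apply: contrapT => Bw; apply: nw; exists w.
exists A; last first.
  have [_ /allpairsP[[a w] /= [Fa /[!inE]/eqP-> ->]]] := avA 1%N.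
  by rewrite mulr1; exists a.
split=> // [A1|a b Aab].
  by have [w] := avA 0%N; rewrite inE => /eqP->.
apply: contrapT => /not_orP[Aa Ab].
have [|sub|m Bm] := bigger _ (colonl_ideal [set b] idA).
- by move=> x Ax r y _; rewrite -mulrA; apply: AMr.
- by apply: Aa; apply: sub => r _ ->.
have [|sub|n Cn] := bigger _ (colonr_ideal [set w | w \in words F m] idA).
- by move=> x Ax y _ r; apply: AMl.
- by apply: Ab; apply: sub => x /Bm Bx r; apply: Bx.
have [w /words_split[u [v [Fu Fv ->]]]] := avA (m + n)%N.
by apply; have := Cn v Fv u Fu 1; rewrite mulr1.
Qed.

Definition prime_radical : set R := [set a | forall P, prime_ideal P -> P a].

Lemma prime_radical_ideal : ideal prime_radical.
Proof.
split=> [P pP|a b Na Nb P pP|r a Na P pP|a r Na P pP]; have idP := prime_ideal_ideal pP.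
- exact: ideal_0.
- by apply: ideal_D => //; [apply: Na | apply: Nb].
- by apply: ideal_Ml => //; apply: Na.
- by apply: ideal_Mr => //; apply: Na.
Qed.

Lemma prime_radical_locally_nilpotent F : {in F, forall a, prime_radical a} ->
  exists n, {in words F n, forall w, w = 0}.
Proof.
move=> NF; apply: contrapT => noN.
have [n|P pP [a Fa]] := @words_prime F; last by apply; apply: NF.
apply: contrapT => now; apply: noN; exists n => w Fw.
by apply: contrapT => /eqP w0; apply: now; exists w.
Qed.

Lemma prime_radical_nil : nil prime_radical.
Proof.
move=> a Na; have [x|n Fn] := @prime_radical_locally_nilpotent [:: a].
  by rewrite inE => /eqP->.
exists n; apply: Fn; elim: n => [|n IHn]; first exact: mem_head.
by rewrite exprS; apply/allpairsP; exists (a, a ^+ n); rewrite mem_head.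
Qed.

(** Nil right ideals lie in every prime by the polynomial identity, and the
    prime radical is itself a nil right ideal. *)
Lemma nil_radicalE d : triangular R d -> nil_radical R = prime_radical.
Proof.
move=> triR; apply/seteqP; split=> [a [s -> nil_s] P pP|a Na].
  rewrite big_seq; apply: ideal_sum => [|b /nil_s[I [rI nilI Ib]]].
    exact: prime_ideal_ideal.
  apply: (nil_mod_prime triR pP rI) Ib => c /nilI[n cn]; exists n; rewrite cn.
  by apply: ideal_0; apply: prime_ideal_ideal.
exists [:: a]; first by rewrite big_seq1.
move=> b; rewrite inE => /eqP->; exists prime_radical; split=> //.
- by apply: ideal_right; apply: prime_radical_ideal.
- exact: prime_radical_nil.
Qed.

End PrimeRadical.

Arguments prime_radical R : clear implicits.

(** * Derivations and prime ideals in characteristic zero *)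
Section Derivation.
Variables (R : nzRingType) (delta : derivation R).

Lemma derivation_leibniz n a b : iter n delta (a * b) =
  \sum_(i < n.+1) (iter i delta a * iter (n - i) delta b) *+ 'C(n, i).
Proof.
elim: n a b => [|n IHn] a b; first by rewrite big_ord1 /= bin0.
have iterD u v : iter n delta (u + v) = iter n delta u + iter n delta v.
  by elim: n {IHn} => //= m ->; rewrite raddfD.
pose E i := iter i delta a * iter (n.+1 - i) delta b.
have -> : \sum_(i < n.+2) E i *+ 'C(n.+1, i) =
    \sum_(i < n.+1) E i.+1 *+ 'C(n, i) + \sum_(i < n.+2) E i *+ 'C(n, i).
  rewrite [LHS]big_ord_recl [X in _ = _ + X]big_ord_recl [RHS]addrCA -big_split.
  rewrite /= !bin0.
  by congr (_ + _); apply: eq_bigr => i _; rewrite binS addnC mulrnDr.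
rewrite iterSr derivationM iterD !IHn; congr (_ + _).
  by apply: eq_bigr => i _; rewrite -iterSr.
rewrite [RHS]big_ord_recr /= bin_small // mulr0n addr0.
by apply: eq_bigr => i _; rewrite /E subSn ?iterSr // -ltnS.
Qed.

Definition delta_stable (I : set R) := forall a, I a -> I (delta a).

(** The largest derivation-stable ideal inside P, when P is an ideal. *)
Definition delta_core (P : set R) : set R := [set a | forall n, P (iter n delta a)].

Lemma delta_core_stable P : delta_stable (delta_core P).
Proof. by move=> a Pa n; rewrite -iterSr. Qed.

Lemma delta_core_sub P : delta_core P `<=` P.
Proof. by move=> a /(_ 0). Qed.

(** All other terms of the Leibniz formula have fewer than i derivations on a or
    fewer than j on b. *)
Lemma leibniz_mod (P : set R) i j a b : ideal P ->
    (forall p, (p < i)%N -> P (iter p delta a)) ->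
    (forall q, (q < j)%N -> P (iter q delta b)) ->
  P (iter (i + j) delta (a * b)
     - (iter i delta a * iter j delta b) *+ 'C(i + j, i)).
Proof.
move=> idP Pa Pb; have lt_i : (i < (i + j).+1)%N by rewrite ltnS leq_addr.
rewrite derivation_leibniz (bigD1 (Ordinal lt_i)) //= addKn addrAC subrr add0r.
apply: ideal_sum => // s ne_s; rewrite -mulr_natr; apply: ideal_Mr => //.
have [lt_si|lt_is|Esi] := ltngtP s i.
- by apply: ideal_Mr => //; apply: Pa.
- by apply: ideal_Ml => //; apply: Pb; have := ltn_ord s; lia.
- by case/eqP: ne_s; apply: val_inj.
Qed.

Lemma iter_delta_left (P : set R) j a b : ideal P ->
  (forall q, (q <= j)%N -> P (iter q delta b)) -> P (iter j delta (a * b)).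
Proof.
move=> idP Pb; rewrite derivation_leibniz; apply: ideal_sum => // i _.
by rewrite -mulr_natr; apply: ideal_Mr => //; apply: ideal_Ml => //; apply: Pb; lia.
Qed.

Lemma iter_delta_right (P : set R) i a b : ideal P ->
  (forall p, (p <= i)%N -> P (iter p delta a)) -> P (iter i delta (a * b)).
Proof.
move=> idP Pa; rewrite derivation_leibniz; apply: ideal_sum => // j _.
rewrite -mulr_natr; apply: ideal_Mr => //; apply: ideal_Mr => //; apply: Pa.
by rewrite -ltnS.
Qed.

Lemma delta_core_ideal P : ideal P -> ideal (delta_core P).
Proof.
move=> idP; have iterD n a b :
    iter n delta (a + b) = iter n delta a + iter n delta b.
  by elim: n => //= n ->; rewrite raddfD.
split=> [n|a b Pa Pb n|r a Pa n|a r Pa n].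
- by elim: n {iterD} => [|n IHn]; [exact: ideal_0 | rewrite iterSr raddf0].
- by rewrite iterD; apply: ideal_D.
- by apply: iter_delta_left.
- by apply: iter_delta_right.
Qed.

(** If a and b leave P for the first time after i and j derivations, the
    derivative of order i + j of a r b is, modulo P, an invertible integer times
    delta^i(a) r delta^j(b). *)
Lemma delta_core_prime P : (forall n, exists c : R, c * n.+1%:R = 1) ->
  prime_ideal P -> prime_ideal (delta_core P).
Proof.
move=> invn primeP; have idP := prime_ideal_ideal primeP.
split=> [||a b Pab]; first exact: delta_core_ideal.
  by move/delta_core_sub; apply: prime_ideal_proper.
have divP n x : P (x *+ n.+1) -> P x.
  have [c cn] := invn n; move=> Px; rewrite -[x]mul1r -cn -mulrA mulr_natl.
  exact: ideal_Ml.
have least x : ~ delta_core P x -> exists2 i, ~ P (iter i delta x) &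
    forall p, (p < i)%N -> P (iter p delta x).
  move=> /existsNP[n Pn]; have ex_n : exists n, `[< ~ P (iter n delta x) >].
    by exists n; apply/asboolP.
  case: (ex_minnP ex_n) => i /asboolP Pi min_i; exists i => // p lt_pi.
  apply: contrapT => Pp; have := min_i p; rewrite leqNgt lt_pi.
  by move=> minp; suff: false by []; apply: minp; apply/asboolP.
apply: contrapT => /not_orP[/least[i Pi lti] /least[j Pj ltj]].
have [|//|//] := prime_ideal_prime primeP (a := iter i delta a) (b := iter j delta b).
move=> r; have Prb q : (q < j)%N -> P (iter q delta (r * b)).
  by move=> lt_qj; apply: iter_delta_left => // p le_pq; apply: ltj; lia.
have Pirb : P (iter i delta a * iter j delta (r * b)).
  have := leibniz_mod idP lti Prb; have: (0 < 'C(i + j, i))%N by rewrite bin_gt0 leq_addr.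
  case: 'C(_, _) => // c _ Pc; apply: (divP c).
  rewrite -[X in P X](subKr (iter (i + j) delta (a * (r * b)))).
  by apply: ideal_B => //; rewrite mulrA; apply: Pab.
have Pd : P (iter j delta (r * b) - r * iter j delta b).
  by have := @leibniz_mod P 0 j r b idP; rewrite bin0 add0n mulr1n; apply.
rewrite -mulrA -[X in P X](subKr (iter i delta a * iter j delta (r * b))) -mulrBr.
by apply: ideal_B => //; apply: ideal_Ml.
Qed.

End Derivation.

(** * The Jacobson radical as an intersection of maximal right ideals *)
Section Jacobson.
Variable S : nzRingType.
Implicit Types (I M : set S).

Lemma right_ideal_proper I : right_ideal I -> I <> setT <-> ~ I 1.
Proof.
move=> [_ _ IM]; split=> [I_T I1|I1 I_T]; last by apply: I1; rewrite I_T.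
by apply: I_T; apply/seteqP; split=> // a _; rewrite -(mul1r a); apply: IM.
Qed.

(** The empty set is admitted in Z only to bound the empty chain. *)
Lemma right_ideal_maximal I : right_ideal I -> ~ I 1 ->
  exists2 M, maximal_right_ideal M & I `<=` M.
Proof.
move=> rI I1; pose Z X := X = set0 \/ [/\ right_ideal X, I `<=` X & ~ X 1].
have [C sCZ totC|M [ZM maxM]] := @Zorn_bigcup S Z.
  have [[X CX [x Xx]]|C0] := pselect (exists2 X, C X & X !=set0); last first.
    left; apply/seteqP; split=> // x [X CX Xx]; apply: C0; exists X => //.
    by exists x.
  right.
  have CP Y y : C Y -> Y y -> [/\ right_ideal Y, I `<=` Y & ~ Y 1].
    by move=> /sCZ[-> //|].
  have [[X0 _ _] sIX _] := CP _ _ CX Xx.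
  split; last 2 first.
  - by move=> a Ia; exists X => //; apply: sIX.
  - by case=> Y CY Y1; have [_ _] := CP _ _ CY Y1.
  split=> [|a b [Y CY Ya] [Y' CY' Yb]|a r [Y CY Ya]]; first by exists X.
  - have [sYY'|sY'Y] := totC _ _ CY CY'.
      by exists Y' => //; have [[_ YD _] _ _] := CP _ _ CY' Yb; apply: YD => //; apply: sYY'.
    by exists Y => //; have [[_ YD _] _ _] := CP _ _ CY Ya; apply: YD => //; apply: sY'Y.
  - by exists Y => //; have [[_ _ YM] _ _] := CP _ _ CY Ya; apply: YM.
case: ZM => [M0|[rM sIM M1]].
  case: (maxM I); last by right; split.
  rewrite M0; split=> // sI0; have [I0 _ _] := rI; exact: sI0 I0.
exists M => //; split=> // [|X rX sMX /(right_ideal_proper rX) X1].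
  by apply/right_ideal_proper.
apply/seteqP; split=> //; apply: contrapT => nsXM; apply: (maxM X); first by split.
by right; split=> //; apply: subset_trans sMX.
Qed.

Lemma jacobson_right_ideal : right_ideal (jacobson S).
Proof.
split=> [M [[M0 _ _] _ _] //|a b Ja Jb M mM|a r Ja M mM]; have [[M0 MD MM] _ _] := mM.
- by apply: MD; [apply: Ja | apply: Jb].
- by apply: MM; apply: Ja.
Qed.

Lemma jacobson_quasi_regular a : jacobson S a -> exists b, (1 - a) * b = 1.
Proof.
move=> Ja; apply: contrapT => noB; pose I := [set (1 - a) * b | b in setT].
have rI : right_ideal I.
  split=> [|_ _ [b _ <-] [c _ <-]|_ r [b _ <-]].
  - by exists 0; rewrite ?mulr0.
  - by exists (b + c); rewrite ?mulrDr.
  - by exists (b * r); rewrite ?mulrA.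
have [|M mM sIM] := right_ideal_maximal rI.
  by case=> b _ ab; apply: noB; exists b.
have [rM /(right_ideal_proper rM) M1 _] := mM; apply: M1.
have [_ MD _] := rM; rewrite -[1](subrK a); apply: MD; last exact: Ja.
by apply: sIM; exists 1; rewrite ?mulr1.
Qed.

Lemma maximal_right_ideal_add M a : maximal_right_ideal M -> ~ M a ->
  exists m r, M m /\ 1 = m + a * r.
Proof.
move=> [rM M_T maxM] Ma; have [M0 MD MM] := rM.
pose I := [set x | exists m r, M m /\ x = m + a * r].
have rI : right_ideal I.
  split=> [|_ _ [m [r [Mm ->]]] [n [s [Mn ->]]]|_ t [m [r [Mm ->]]]].
  - by exists 0, 0; rewrite mulr0 addr0.
  - by exists (m + n), (r + s); rewrite mulrDr addrACA; split=> //; apply: MD.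
  - by exists (m * t), (r * t); rewrite mulrDl mulrA; split=> //; apply: MM.
have sMI : M `<=` I by move=> m Mm; exists m, 0; rewrite mulr0 addr0.
apply: contrapT => nI1; apply: Ma; rewrite -(maxM I) //.
  by exists 0, 1; rewrite mulr1 add0r.
by apply/right_ideal_proper.
Qed.

(** If r is not in M, the set of x with r x in M is again a maximal right
    ideal. *)
Lemma jacobson_Ml r a : jacobson S a -> jacobson S (r * a).
Proof.
move=> Ja M mM; have [rM M_T maxM] := mM; have [M0 MD MM] := rM.
have [Mr|Mr] := pselect (M r); first exact: MM.
pose K := [set x | M (r * x)].
have rK : right_ideal K.
  split=> [|x y Kx Ky|x s Kx]; rewrite /K /= ?mulr0 ?mulrDr ?mulrA //.
  - exact: MD.
  - exact: MM.
have K1 : ~ K 1 by rewrite /K /= mulr1.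
suff: K a by []; apply: Ja; split=> // [|X rX sKX /(right_ideal_proper rX) X1].
  by apply/right_ideal_proper.
apply/seteqP; split=> // x Xx; apply: contrapT => Kx.
have [m [s [Mm def1]]] := maximal_right_ideal_add mM Kx.
have [X0 XD XM] := rX; apply: X1; rewrite -[1](subrK (x * s * r)).
apply: XD; last by rewrite -mulrA; apply: XM.
apply: sKX; rewrite /K /= mulrBr mulr1.
by rewrite -[X in X - _]mul1r {1}def1 mulrDl !mulrA addrK; apply: MM.
Qed.

Lemma nil_right_ideal_jacobson I : right_ideal I -> nil I -> I `<=` jacobson S.
Proof.
move=> [_ _ IM] nilI a Ia M mM; apply: contrapT => Ma.
have [m [r [Mm def1]]] := maximal_right_ideal_add mM Ma.
have [rM /(right_ideal_proper rM) M1 _] := mM; apply: M1.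
have [n arn] := nilI _ (IM _ r Ia); have [_ _ MM] := rM.
have {def1} def_m : m = 1 - a * r by rewrite def1 addrK.
have := subrXX_comm n (commr_sym (commr1 (a * r))).
by rewrite expr1n arn subr0 -def_m => ->; apply: MM.
Qed.

End Jacobson.

(** * The Jacobson radical modulo a derivation-stable prime *)
Section Coefficients.
Variables (R : nzRingType) (delta : derivation R).
Implicit Types f g h : diffpoly delta.
Local Notation act := (dpX_act delta).

Lemma coef_act (q : {poly R}) e :
  (act q)`_e = (if e is e'.+1 then q`_e' else 0) + delta q`_e.
Proof. by rewrite /dpX_act coefD coefMX coef_map; case: e. Qed.

(** Any bound n on the size of f is allowed, so that sums can be split at a chosen
    index. *)
Lemma coef_dpmul n f g e : (size (f : {poly R}) <= n)%N ->
  ((f * g : diffpoly delta) : {poly R})`_e =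
    \sum_(i < n) (f : {poly R})`_i * (iter i act g)`_e.
Proof.
move=> le_fn; rewrite -[f * g]/(dpmul f g) (@dpmul_wide _ delta n f g le_fn) coef_sum.
by apply: eq_bigr => i _; rewrite coefZ.
Qed.

Lemma dpX_mul g : dpX delta * g = act g.
Proof.
have -> : dpX delta = act 1 by rewrite -[RHS]/(iter 1 act 1) iter_dpX_act1 expr1.
rewrite -[LHS]/(dpmul (act 1) g) dpmul_X_act; congr act; apply: dpmul1l.
Qed.

Lemma dp_over_right_ideal (I : set R) : right_ideal I -> right_ideal (dp_over delta I).
Proof.
move=> [I0 ID IM]; split=> [i|f g If Ig i|f g If i].
- by rewrite coef0.
- by rewrite coefD; apply: ID.
by rewrite (coef_dpmul _ _ (leqnn _)); elim/big_ind: _ => // j _; apply: IM.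
Qed.

Lemma iter_act_over (I : set R) g n : ideal I -> delta_stable delta I ->
  dp_over delta I g -> dp_over delta I (iter n act g).
Proof.
move=> idI dI Ig; elim: n => //= n IHn e; rewrite coef_act; apply: ideal_D => //.
  by case: e => [|e]; [apply: ideal_0 | apply: IHn].
exact/dI/IHn.
Qed.

Section Leading.
Variable I : set R.
Hypotheses (idI : ideal I) (dI : delta_stable delta I).

Lemma iter_act_leading g m n : (forall j, (m < j)%N -> I (g : {poly R})`_j) ->
  (forall j, (m + n < j)%N -> I (iter n act g)`_j) /\
  I ((iter n act g)`_(m + n) - (g : {poly R})`_m).
Proof.
move=> Ig; elim: n => [|n [IHhigh IHlead]].
  by rewrite addn0 subrr; split=> //; apply: ideal_0.
rewrite /= addnS; split=> [[//|j] lt_j|]; rewrite coef_act.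
  by apply: ideal_D => //; [apply: IHhigh | apply/dI/IHhigh; apply: leqW].
by rewrite addrAC; apply: ideal_D => //; apply: dI; apply: IHhigh.
Qed.

(** Modulo a derivation-stable ideal, degrees and leading coefficients behave as
    in an ordinary polynomial ring. *)
Lemma dpmul_leading f g n m :
    (forall i, (n < i)%N -> I (f : {poly R})`_i) ->
    (forall j, (m < j)%N -> I (g : {poly R})`_j) ->
  (forall e, (n + m < e)%N -> I ((f * g : diffpoly delta) : {poly R})`_e) /\
  I (((f * g : diffpoly delta) : {poly R})`_(n + m)
     - (f : {poly R})`_n * (g : {poly R})`_m).
Proof.
move=> If Ig; pose N := maxn (size (f : {poly R})) n.+1.
have le_fN : (size (f : {poly R}) <= N)%N by apply: leq_maxl.
have lt_nN : (n < N)%N by apply: leq_maxr.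
split=> [e lt_e|].
  rewrite (coef_dpmul _ _ le_fN); apply: ideal_sum => // i _.
  have [le_in|lt_ni] := leqP i n; last by apply: ideal_Mr => //; apply: If.
  apply: ideal_Ml => //; have [+ _] := iter_act_leading i Ig; apply.
  by rewrite addnC (leq_ltn_trans _ lt_e) // leq_add2r.
rewrite (coef_dpmul _ _ le_fN) (bigD1 (Ordinal lt_nN)) //= addrAC.
apply: ideal_D => //.
  by rewrite -mulrBr addnC; apply: ideal_Ml => //; have [] := iter_act_leading n Ig.
apply: ideal_sum => // i ne_i; have [lt_in|lt_ni|Ein] := ltngtP i n.
- apply: ideal_Ml => //; have [+ _] := iter_act_leading i Ig; apply.
  by rewrite addnC ltn_add2r.
- by apply: ideal_Mr => //; apply: If.
- by case/eqP: ne_i; apply: val_inj.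
Qed.

Lemma not_over_leading f : ~ dp_over delta I f ->
  exists2 n, ~ I (f : {poly R})`_n & forall i, (n < i)%N -> I (f : {poly R})`_i.
Proof.
move=> /existsNP[j Ij].
have ex_n : exists n, `[< ~ I (f : {poly R})`_n >] by exists j; apply/asboolP.
have max_n n : `[< ~ I (f : {poly R})`_n >] -> (n <= size (f : {poly R}))%N.
  move=> /asboolP In; rewrite leqNgt; apply/negP => lt_n; apply: In.
  by rewrite nth_default ?(ltnW lt_n) //; apply: ideal_0.
case: (ex_maxnP ex_n max_n) => n /asboolP In maxn; exists n => // i lt_ni.
apply: contrapT => Ii; suff: (i <= n)%N by rewrite leqNgt lt_ni.
by apply: maxn; apply/asboolP.
Qed.

End Leading.

(** The leading coefficients, modulo P and in the degree n of f, of elements of J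
    form an ideal that is not inside P; a regular one belongs to some h.  The
    factor x gives x h positive degree, so that 1 - x h has the same regular
    leading coefficient and cannot have a right inverse g. *)
Lemma jacobson_over_prime d (P : set R) : triangular R d -> prime_ideal P ->
  delta_stable delta P -> jacobson (diffpoly delta) `<=` dp_over delta P.
Proof.
move=> triR primeP dP f Jf; have idP := prime_ideal_ideal primeP.
apply: contrapT => /(not_over_leading idP)[n Pfn Pf].
pose A c := exists h, [/\ jacobson (diffpoly delta) h, P ((h : {poly R})`_n - c) &
  forall i, (n < i)%N -> P (h : {poly R})`_i].
have [J0 JD JM] := jacobson_right_ideal (diffpoly delta).
have idA : ideal A.
  split=> [|a b [h [Jh Pa Ph]] [q [Jq Pb Pq]]|r a [h [Jh Pa Ph]]|a r [h [Jh Pa Ph]]].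
  - by exists 0; split=> // [|i _]; rewrite coef0 ?subrr; apply: ideal_0.
  - exists (h + q); split=> [||i lt_ni]; first exact: JD.
      by rewrite coefD opprD addrACA; apply: ideal_D.
    by rewrite coefD; apply: ideal_D; auto.
  - exists (dpC delta r * h); split=> [||i lt_ni]; first exact: jacobson_Ml.
      by rewrite [dpC delta r * h]dpmulCl coefZ -mulrBr; apply: ideal_Ml.
    by rewrite [dpC delta r * h]dpmulCl coefZ; apply: ideal_Ml; auto.
  have [|Ph_hi Ph_n] := @dpmul_leading P idP dP h (dpC delta r) n 0 Ph.
    by case=> // j _; rewrite /dpC coefC; apply: ideal_0.
  exists (h * dpC delta r); rewrite addn0 in Ph_hi Ph_n; split=> //; first exact: JM.
  have := ideal_D idP Ph_n (ideal_Mr idP r Pa).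
  by rewrite /dpC coefC /= mulrBl addrA subrK.
have [|c [h [Jh Pc Ph]] regc] := ideal_regular_mod_prime triR primeP idA.
  move=> sAP; apply: Pfn; apply: sAP; exists f; split=> //.
  by rewrite subrr; apply: ideal_0.
have [g def1] := jacobson_quasi_regular (jacobson_Ml (dpX delta) Jh).
have [Pq_hi Pq_n] := iter_act_leading idP dP 1 Ph.
rewrite addn1 /= -dpX_mul in Pq_hi Pq_n; set q := dpX delta * h in def1 Pq_hi Pq_n.
have def_g : g = 1 + q * g by rewrite -def1 mulrBl mul1r subrK.
have [|m Pgm Pg] := @not_over_leading P idP g.
  move=> Pg; apply: (prime_ideal_proper primeP).
  have -> : 1 = ((1 : diffpoly delta) : {poly R})`_0 by rewrite coef1.
  rewrite -def1 (coef_dpmul _ _ (leqnn _)); apply: ideal_sum => // i _.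
  by apply: ideal_Ml => //; apply: iter_act_over.
have [_ Pqg] := dpmul_leading idP dP Pq_hi Pg; apply: Pgm; apply: regc.
have Pqc : P ((q : {poly R})`_n.+1 - c).
  by have := ideal_D idP Pq_n Pc; rewrite addrA subrK.
set gm := (g : {poly R})`_m in Pqg *; set qn := (q : {poly R})`_n.+1 in Pqg Pqc.
have -> : c * gm = qn * gm - (qn - c) * gm by rewrite mulrBl subKr.
apply: ideal_B => //; last exact: ideal_Mr.
rewrite -[X in P X](subKr ((q * g : diffpoly delta) : {poly R})`_(n.+1 + m)).
apply: ideal_B => //.
have -> : q * g = g - 1 by rewrite [in RHS]def_g addrC addKr.
rewrite coefB coef1 addSn subr0; apply: Pg; lia.
Qed.

End Coefficients.

(** * Powers of the prime radical *)
Section StronglyNilpotent.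
Variable R : nzRingType.
Implicit Types (I J X Y A : set R) (F : seq R).

Inductive ideal_gen X : R -> Prop :=
  | ideal_gen0 : ideal_gen X 0
  | ideal_genD a b : ideal_gen X a -> ideal_gen X b -> ideal_gen X (a + b)
  | ideal_genMl r a : ideal_gen X a -> ideal_gen X (r * a)
  | ideal_genMr a r : ideal_gen X a -> ideal_gen X (a * r)
  | ideal_gen_mem a : X a -> ideal_gen X a.

Lemma ideal_gen_ideal X : ideal (ideal_gen X).
Proof.
split; [exact: ideal_gen0 | exact: ideal_genD | exact: ideal_genMl | exact: ideal_genMr].
Qed.

Lemma ideal_genS X Y : X `<=` Y -> ideal_gen X `<=` ideal_gen Y.
Proof.
move=> sXY a; elim=> {a} [|a b _ + _|r a _|a r _|a /sXY]; [exact: ideal_gen0 |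
  exact: ideal_genD | exact: ideal_genMl | exact: ideal_genMr | exact: ideal_gen_mem].
Qed.

Definition colon_pow A X n : set R := iter n (fun I => colonl I X) A.

(** Equivalently, the two-sided ideal generated by X is nilpotent: the n-fold colon
    ideal consists of the a with a r_1 x_1 ... r_n x_n = 0 for all r_i and all
    x_i in X. *)
Definition strongly_nilpotent X := exists n, colon_pow [set 0] X n 1.

Lemma zero_ideal : ideal [set 0 : R].
Proof.
by split=> [//|a b -> ->|r a ->|a r ->] /=; rewrite ?addr0 ?mulr0 ?mul0r.
Qed.

Lemma colonlS I J X Y : I `<=` J -> Y `<=` X -> colonl I X `<=` colonl J Y.
Proof. by move=> sIJ sYX a Ia r x /sYX Xx; apply/sIJ/Ia. Qed.

Lemma colon_pow_ideal A X n : ideal A -> ideal (colon_pow A X n).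
Proof. by move=> idA; elim: n => //= n; apply: colonl_ideal. Qed.

Lemma colon_powS A X Y n : Y `<=` X -> colon_pow A X n `<=` colon_pow A Y n.
Proof. by move=> sYX; elim: n => //= n IHn; apply: colonlS. Qed.

Lemma strongly_nilpotentS X Y : Y `<=` X -> strongly_nilpotent X -> strongly_nilpotent Y.
Proof. by move=> sYX [n Xn]; exists n; apply: colon_powS Xn. Qed.

(** For fixed a, the elements x with a r x in I for all r form an ideal. *)
Lemma colonl_gen I X : ideal I -> colonl I X `<=` colonl I (ideal_gen X).
Proof.
move=> idI a Ia r x gx; elim: gx r => {x} [|x y _ IHx _ IHy|s x _ IHx|x s _ IHx|x Xx] r.
- by rewrite mulr0; apply: ideal_0.
- by rewrite mulrDr; apply: ideal_D.
- by rewrite mulrA -[a * r * s]mulrA.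
- by rewrite mulrA; apply: ideal_Mr.
- exact: Ia.
Qed.

Lemma strongly_nilpotent_gen X :
  strongly_nilpotent X -> strongly_nilpotent (ideal_gen X).
Proof.
case=> n Xn; exists n; apply: (_ : colon_pow _ X n `<=` _) Xn.
elim: n => //= n IHn; apply: subset_trans (colonl_gen _) _.
  by apply: colon_pow_ideal; apply: zero_ideal.
exact: colonlS.
Qed.

Lemma colon_powP A X n a :
    (forall r w : nat -> R, (forall i, (i < n)%N -> X (w i)) ->
      A (a * \prod_(i < n) (r i * w i))) ->
  colon_pow A X n a.
Proof.
elim: n a => [|n IHn] a Aa /=.
  by have := Aa (fun _ => 0) (fun _ => 0); rewrite big_ord0 mulr1; apply.
move=> r x Xx; apply: IHn => r' w Xw.
have := Aa (fun i => if i is j.+1 then r' j else r) (fun i => if i is j.+1 then w j else x).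
by rewrite big_ord_recl /= !mulrA; apply=> -[//|i] lt_in; apply: Xw.
Qed.

Lemma colon_pow_prod F n a (s : seq R) :
    colon_pow [set 0] [set x | x \in F] n a -> (n <= count (mem F) s)%N ->
  a * \prod_(b <- s) b = 0.
Proof.
elim: s n a => [|b s IHs] [|n] a //=; rewrite ?[colon_pow _ _ 0 _]/(_ = _).
- by move=> -> _; rewrite mul0r.
- by move=> -> _; rewrite mul0r.
rewrite big_cons mulrA => Fa; case: (boolP (b \in F)) => [Fb|_] lt_n.
  by apply: (IHs n) lt_n; have := Fa 1 b Fb; rewrite mulr1.
apply: (IHs n.+1) lt_n; apply: (ideal_Mr (colon_pow_ideal _ n.+1 zero_ideal)) Fa.
Qed.

Section Triangular.
Variables (d : nat) (triR : triangular R d).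

(** Split each word w_i of length t as y_i x_i with y_i of length i.  For j < i the
    product y_i x_j is longer than t, so [triangular_interleave] puts every
    product of d + 1 words of length t, interleaved with arbitrary factors, in
    the ideal generated by the words of length t + 1. *)
Lemma words_colon F t A : (d <= t)%N ->
  colonl A (ideal_gen [set w | w \in words F t.+1])
    `<=` colon_pow A [set w | w \in words F t] d.+1.
Proof.
move=> le_dt a Aa; apply: colon_powP => r w Fw; rewrite big_ord_recl /= !mulrA -mulrA.
apply: Aa; set Q := ideal_gen _.
have split_w i : {yx : R * R | (i <= d)%N -> [/\ yx.1 \in words F i,
    yx.2 \in words F (t - i) & w i = yx.1 * yx.2]}.
  apply/cid; have [le_id|_] := leqP i d; last by exists (0, 0).
  have := Fw i le_id; rewrite /= -{1}(subnKC (leq_trans le_id le_dt)).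
  by case/words_split=> y [x [Fy Fx ->]]; exists (y, x).
pose y i := (sval (split_w i)).1; pose x i := (sval (split_w i)).2.
have wE i : (i <= d)%N -> w i = y i * x i by move=> /(svalP (split_w i))[].
have Q_yx i j : (j < i <= d)%N -> Q (y i * x j).
  case/andP=> lt_ji le_id; have [Fy _ _] := svalP (split_w i) le_id.
  have [_ Fx _] := svalP (split_w j) (ltnW (leq_trans lt_ji le_id)).
  have := words_cat Fy Fx.
  have -> : (i + (t - j) = t.+1 + (i - j.+1))%N by lia.
  case/words_split=> u [v [Fu _ ->]]; apply: ideal_genMr; exact: ideal_gen_mem.
have := triangular_interleave triR (fun i => r i.+1) (ideal_gen_ideal _) Q_yx.
rewrite -wE // (eq_bigr (fun i : 'I_d => r i.+1 * w i.+1)) // => i _.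
by rewrite wE.
Qed.

Lemma words_strongly_nilpotentS F t : (d <= t)%N ->
  strongly_nilpotent [set w | w \in words F t.+1] ->
  strongly_nilpotent [set w | w \in words F t].
Proof.
move=> le_dt /strongly_nilpotent_gen[n]; set Q := ideal_gen _ => Qn.
exists (n * d.+1)%N; apply: (_ : colon_pow _ Q n `<=` _) Qn.
elim: n => // n IHn; rewrite mulSn /colon_pow iterD -/(colon_pow _ _ _).
apply: subset_trans (words_colon le_dt).
exact: colonlS.
Qed.

(** Local nilpotence makes long words vanish; then descend from their length to
    d. *)
Lemma words_strongly_nilpotent F : {in F, forall a, prime_radical R a} ->
  strongly_nilpotent [set w | w \in words F d].
Proof.
move=> /prime_radical_locally_nilpotent[n Fn].
have: strongly_nilpotent [set w | w \in words F (d + n)].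
  exists 1%N => r x /=; rewrite addnC => /words_split[u [v [/Fn-> _ ->]]].
  by rewrite mul0r mulr0.
elim: n {Fn} => [|n IHn]; first by rewrite addn0.
by rewrite addnS => /words_strongly_nilpotentS Fn; apply/IHn/Fn/leq_addr.
Qed.

End Triangular.

Fixpoint ideal_pow I n : set R := if n is m.+1
  then ideal_gen [set x | exists a b, [/\ I a, ideal_pow I m b & x = a * b]]
  else setT.

Lemma ideal_pow_ideal I n : ideal (ideal_pow I n).
Proof. by case: n => [//|n]; apply: ideal_gen_ideal. Qed.

Lemma words_genS F F' n : {subset F <= F'} ->
  ideal_gen [set w | w \in words F n] `<=` ideal_gen [set w | w \in words F' n].
Proof. by move=> sFF'; apply: ideal_genS => w /=; apply: words_sub. Qed.

(** A finite sum of products of n elements of I involves finitely many of them;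
    since I absorbs the coefficients, the left factors can be moved into the
    letters. *)
Lemma ideal_pow_words I n b : ideal I -> ideal_pow I n b ->
  exists2 F, {in F, forall a, I a} & ideal_gen [set w | w \in words F n] b.
Proof.
move=> idI; elim: n b => [|n IHn] b.
  exists [::] => //; rewrite -[b]mulr1; apply/ideal_genMl/ideal_gen_mem.
  exact: mem_head.
pose fin n x := exists2 F, {in F, forall a, I a} & ideal_gen [set w | w \in words F n] x.
have finD m x y : fin m x -> fin m y -> fin m (x + y).
  move=> [F IF Fx] [G IG Gy]; exists (F ++ G).
    by move=> a; rewrite mem_cat => /orP[/IF|/IG].
  apply: ideal_genD; [apply: words_genS Fx | apply: words_genS Gy] => a Fa;
    by rewrite mem_cat Fa ?orbT.
have fin0 m : fin m 0 by exists [::] => //; apply: ideal_gen0.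
rewrite -/(fin n.+1 b) => gen_b.
elim: {b} gen_b => [|x y _ IHx _ IHy|r x _ [F IF Fx]|x r _ [F IF Fx]
                   |_ [a [b [Ia /IHn[F IF Fb] ->]]]].
- exact: fin0.
- exact: finD.
- by exists F => //; apply: ideal_genMl.
- by exists F => //; apply: ideal_genMr.
elim: Fb a Ia => {b} [|x y _ IHx _ IHy|r x _ IHx|x r _ IHx|w Fw] a Ia.
- by rewrite mulr0; apply: fin0.
- by rewrite mulrDr; apply: finD; auto.
- by rewrite mulrA; apply: IHx; apply: ideal_Mr.
- by rewrite mulrA; have [G IG Gx] := IHx a Ia; exists G => //; apply: ideal_genMr.
exists (a :: F); first by move=> c; rewrite inE => /predU1P[->|/IF].
apply: ideal_gen_mem; apply/allpairsP; exists (a, w); rewrite mem_head; split=> //.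
by apply: words_sub Fw => c Fc; rewrite inE Fc orbT.
Qed.

(** Finitely many elements of N^d lie in the ideal generated by the words of
    length d in one finite subset of N. *)
Lemma prime_radical_pow_strongly_nilpotent d F : triangular R d ->
    {in F, forall b, ideal_pow (prime_radical R) d b} ->
  strongly_nilpotent [set b | b \in F].
Proof.
move=> triR powF.
have [G NG FG] : exists2 G, {in G, forall a, prime_radical R a} &
    {in F, forall b, ideal_gen [set w | w \in words G d] b}.
  elim: F powF => [|b F IHF] powF; first by exists [::].
  have [|G NG FG] := IHF; first by move=> c Fc; apply: powF; rewrite inE Fc orbT.
  have [H NH bH] := ideal_pow_words (@prime_radical_ideal R) (powF b (mem_head _ _)).
  exists (H ++ G); first by move=> a; rewrite mem_cat => /orP[/NH|/NG].
  move=> c; rewrite inE => /predU1P[->|/FG Gc].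
    by apply: words_genS bH => a Ha; rewrite mem_cat Ha.
  by apply: words_genS Gc => a Ga; rewrite mem_cat Ga orbT.
apply: strongly_nilpotentS (strongly_nilpotent_gen (words_strongly_nilpotent triR NG)).
exact: FG.
Qed.

End StronglyNilpotent.

(** * Nil differential polynomials *)
Section NilPolynomials.
Variables (R : nzRingType) (delta : derivation R).

(** Additive spans are enough, and they stay within a prescribed weight, which
    ideals would not. *)
Inductive add_span (X : set R) : R -> Prop :=
  | add_span0 : add_span X 0
  | add_spanD a b : add_span X a -> add_span X b -> add_span X (a + b)
  | add_span_mem a : X a -> add_span X a.

Lemma add_spanS X Y : X `<=` Y -> add_span X `<=` add_span Y.
Proof.
move=> sXY a; elim=> {a} [|a b _ + _|a /sXY];
  [exact: add_span0 | exact: add_spanD | exact: add_span_mem].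
Qed.

Lemma ideal_pow_stable I n : delta_stable delta I -> delta_stable delta (ideal_pow I n).
Proof.
move=> dI; elim: n => [//|n IHn] a /=.
elim=> {a} [|a b _ IHa _ IHb|r a Ia IHa|a r Ia IHa|_ [a [b [Ia Ib ->]]]].
- by rewrite raddf0; apply: ideal_gen0.
- by rewrite raddfD; apply: ideal_genD.
- by rewrite derivationM; apply: ideal_genD; apply: ideal_genMl.
- by rewrite derivationM; apply: ideal_genD; apply: ideal_genMr.
rewrite derivationM; apply: ideal_genD; apply: ideal_gen_mem.
  by exists (delta a), b; split=> //; apply: dI.
by exists a, (delta b); split=> //; apply: IHn.
Qed.

Lemma dp_over_pow I (f : diffpoly delta) n : delta_stable delta I ->
  dp_over delta I f -> dp_over delta (ideal_pow I n) (f ^+ n).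
Proof.
move=> dI If; elim: n => [//|n IHn] e.
rewrite exprS (coef_dpmul _ _ (leqnn _)); apply: ideal_sum => [|i _].
  exact: ideal_pow_ideal.
apply: ideal_gen_mem; exists (f : {poly R})`_i, (iter i (dpX_act delta) (f ^+ n))`_e.
split=> //; apply: iter_act_over => //; first exact: ideal_pow_ideal.
exact: ideal_pow_stable.
Qed.

Section Weights.
Variable g : diffpoly delta.
Local Notation m := (size (g : {poly R})).

(** A pair (j, i) stands for the j-th derivative of the i-th coefficient of g; the
    weight of a word of letters is the sum of the numbers j. *)
Definition letter (p : nat * nat) : R := iter p.1 delta (g : {poly R})`_p.2.

(** Bounding weight + e by c, and not the weight by c - e, avoids truncated
    subtraction: if e exceeds c there is no such word, and the span is zero. *)
Definition weighted n c e : set R := [set x | exists s : seq (nat * nat),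
  [/\ size s = n, (\sum_(p <- s) p.1 + e <= c)%N, all (fun p => p.2 < m)%N s
    & x = \prod_(p <- s) letter p]].

Lemma weighted_letter n c e p : (p.2 < m)%N -> forall z,
  add_span (weighted n c e) z -> add_span (weighted n.+1 (c + p.1) e) (letter p * z).
Proof.
move=> p_m z; elim=> {z} [|x y _ IHx _ IHy|_ [s [sz_s wt_s s_m ->]]].
- by rewrite mulr0; apply: add_span0.
- by rewrite mulrDr; apply: add_spanD.
apply: add_span_mem; exists (p :: s); rewrite /= sz_s p_m s_m !big_cons.
by split=> //; lia.
Qed.

Lemma weighted_delta n c e z :
  add_span (weighted n c e) z -> add_span (weighted n c.+1 e) (delta z).
Proof.
elim=> {z} [|x y _ IHx _ IHy|_ [s [<- wt_s s_m ->]]].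
- by rewrite raddf0; apply: add_span0.
- by rewrite raddfD; apply: add_spanD.
elim: s c wt_s s_m => [|p s IHs] c.
  have d1 : delta 1 = 0.
    have /eqP := derivationM (s := delta) 1 1.
    by rewrite !mulr1 mul1r -subr_eq0 opprD addNKr oppr_eq0 => /eqP.
  by rewrite !big_nil d1 => *; apply: add_span0.
rewrite !big_cons => wt_s /= /andP[p_m s_m]; rewrite derivationM; apply: add_spanD.
  apply: add_span_mem; exists ((p.1.+1, p.2) :: s); rewrite /= p_m s_m !big_cons /=.
  by split=> //; lia.
have := IHs (c - p.1)%N _ s_m => /(_ _)/(weighted_letter p_m).
have -> : ((c - p.1).+1 + p.1 = c.+1)%N by lia.
by apply; lia.
Qed.

(** Moving one x to the right past an element either shifts the degree e by one or
    applies one derivation, so weight plus degree grows by at most one; each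
    factor g contributes fewer than m such moves. *)
Lemma weighted_exp n e :
  add_span (weighted n (m * n) e) ((g ^+ n : diffpoly delta) : {poly R})`_e.
Proof.
elim: n e => [|n IHn] e.
  rewrite expr0 coef1; case: eqP => [->|_]; last exact: add_span0.
  by apply: add_span_mem; exists [::]; rewrite !big_nil.
rewrite exprS (coef_dpmul _ _ (leqnn _)); elim/big_ind: _ => [||i _].
- exact: add_span0.
- exact: add_spanD.
have act_span j e' : add_span (weighted n (m * n + j) e')
    (iter j (dpX_act delta) (g ^+ n))`_e'.
  elim: j e' => [|j IHj] e'; first by rewrite addn0.
  rewrite /= coef_act; apply: add_spanD; last by rewrite addnS; apply: weighted_delta.
  case: e' => [|e']; first exact: add_span0.
  apply: add_spanS (IHj e') => x [s [sz_s wt_s s_m ->]]; exists s; split=> //.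
  by rewrite !addnS ltnS.
have := weighted_letter (p := (0, i : nat)) (ltn_ord i) (act_span i e).
rewrite /= addn0; apply: add_spanS => x [s [sz_s wt_s s_m ->]]; exists s; split=> //.
by rewrite (leq_trans wt_s) // mulnS addnC leq_add2r ltnW.
Qed.

End Weights.

(** In a word of length 2 K and weight at most 2 K m, at most K letters have more
    than 2 m derivations.  The other letters, at least K of them, belong to the
    finite set F. *)
Lemma strongly_nilpotent_coef_nil (V : set R) (g : diffpoly delta) :
    delta_stable delta V ->
    (forall F : seq R, {in F, forall a, V a} -> strongly_nilpotent [set a | a \in F]) ->
  dp_over delta V g -> exists n, g ^+ n = 0.
Proof.
move=> dV snV Vg; set m := size (g : {poly R}).
pose F := [seq letter g (j, i) | j <- iota 0 (m.*2).+1, i <- iota 0 m].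
have VF : {in F, forall a, V a}.
  move=> _ /allpairsP[[j i] /= [_ _ ->]]; rewrite /letter /=.
  by elim: j => [|j IHj]; [apply: Vg | apply: dV].
have [K F_K] := snV F VF; exists (K.*2)%N; apply/polyP => e; rewrite coef0.
elim: (weighted_exp g K.*2 e) => [//|a b _ -> _ ->|_ [s [sz_s wt_s s_m ->]]].
  by rewrite addr0.
have := @colon_pow_prod R F K 1 [seq letter g p | p <- s] F_K.
rewrite mul1r big_map; apply.
pose heavy (p : nat * nat) := (m.*2 < p.1)%N.
have lightF : (size s <= count (mem F) [seq letter g p | p <- s] + count heavy s)%N.
  elim: s s_m {sz_s wt_s} => //= p s IHs /andP[p_m /IHs{}IHs].
  have: (1 <= (letter g p \in F) + heavy p)%N.
    rewrite /heavy; case: (ltnP m.*2 p.1) => [_|le_p]; first by rewrite addnC.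
    rewrite addn0 lt0b; apply/allpairsP; exists p; rewrite !mem_iota /=.
    by rewrite add0n ltnS le_p p_m; case: (p).
  by rewrite /=; lia.
have heavy_wt : (m.*2.+1 * count heavy s <= \sum_(p <- s) p.1)%N.
  elim: s {s_m sz_s wt_s lightF} => [|p s IHs]; first by rewrite muln0.
  rewrite big_cons /= mulnDr leq_add // /heavy.
  by case: (ltnP m.*2 p.1); rewrite ?muln1 ?muln0.
by move: wt_s lightF heavy_wt; rewrite sz_s -!muln2; nia.
Qed.

End NilPolynomials.

(** * The radical of the differential polynomial ring *)
Section MainSteps.
Variables (R : nzRingType) (delta : derivation R) (d : nat).
Hypotheses (triR : triangular R d) (invn : forall n, exists c : R, c * n.+1%:R = 1).
Local Notation N := (prime_radical R).

Lemma prime_radical_stable : delta_stable delta N.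
Proof.
move=> a Na P primeP.
by apply: (delta_core_stable (Na _ (delta_core_prime delta invn primeP)) 0).
Qed.

Lemma jacobson_diffpoly : jacobson (diffpoly delta) = dp_over delta N.
Proof.
apply/seteqP; split=> [f Jf i P primeP|].
  apply: (@delta_core_sub _ delta).
  apply: (jacobson_over_prime triR) Jf i; last exact: delta_core_stable.
  exact: delta_core_prime.
apply: nil_right_ideal_jacobson.
  by apply: dp_over_right_ideal; apply: ideal_right; apply: prime_radical_ideal.
move=> f Nf.
have [||n fn] := strongly_nilpotent_coef_nil _ _ (dp_over_pow d prime_radical_stable Nf).
- by apply: ideal_pow_stable; apply: prime_radical_stable.
- by move=> F; apply: prime_radical_pow_strongly_nilpotent.
by exists (d * n)%N; rewrite exprM.
Qed.

End MainSteps.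

Lemma natr_inv_char0 (k : fieldType) (R : algType k) : [pchar k] =i pred0 ->
  forall n, exists c : R, c * n.+1%:R = 1.
Proof.
move=> char0 n; exists (n.+1%:R^-1)%:A.
have n0 : n.+1%:R != 0 :> k by rewrite (pcharf0P k).1.
by rewrite mulr_algl -(scaler_nat n.+1) scalerA mulVf // scale1r.
Qed.

Theorem theorem1p2 (k : fieldType) (char0 : [pchar k] =i pred0)
    (R : algType k) (PI_R : satisfies_PI R) (delta : derivation R) :
  let N := nil_radical R in
  let J := jacobson (diffpoly delta) in
  [/\ delta @` N `<=` N,
      J = dp_over delta N &
      J = dp_over delta (dpC delta @^-1` J)].
Proof.
move=> N J; have [d triR] := PI_triangular PI_R.
have invn := natr_inv_char0 R char0.
have NE : N = prime_radical R := nil_radicalE triR.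
have JE : J = dp_over delta N by rewrite NE; apply: jacobson_diffpoly triR invn.
split=> //; first by rewrite NE => _ [a Na <-]; apply: prime_radical_stable.
suff def_N : dpC delta @^-1` J = N by rewrite def_N.
apply/seteqP; split=> a; rewrite /= JE; first by move/(_ 0); rewrite coefC.
move=> Na i; rewrite coefC; case: eqP => // _; rewrite NE.
by apply: ideal_0; apply: prime_radical_ideal.
Qed.
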